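(* Let $(X,\tau)$ be an uncountable Polish space and $1\le\xi<\omega_1$. The ranks $\beta^*_\xi$ and $\gamma^*_\xi$ are essentially linear on the Baire class $\xi$ functions: for all Baire class $\xi$ functions $f,g:X\to\mathbb{R}$ and $c\in\mathbb{R}\setminus\{0\}$, $\rho(cf)\approx\rho(f)$ and $\rho(f+g)\lesssim\max\{\rho(f),\rho(g)\}$ for $\rho\in\{\beta^*_\xi,\gamma^*_\xi\}$.
   Context: $\theta\lesssim\theta'$ means: for every $1\le\eta<\omega_1$, $\theta'\le\omega^\eta$ implies $\theta\le\omega^\eta$; $\approx$ means both directions. For a Baire class $\xi$ function $f$, let $T_{f,\xi}$ be the set of Polish topologies $\tau'\supseteq\tau$ on $X$ with $\tau'\subseteq\boldsymbol\Sigma^0_\xi(\tau)$ such that $f$ is Baire class $1$ with respect to $\tau'$. For a rank $\rho$ on Baire class $1$ functions, $\rho^*_\xi(f)=\min_{\tau'\in T_{f,\xi}}\rho_{\tau'}(f)$, where $\rho_{\tau'}$ is $\rho$ computed in topology $\tau'$. Base ranks (in a topology on $X$): derivatives are monotone maps $D$ on closed sets with $D(F)\subseteq F$; iterates $D^{\eta+1}=D\circ D^\eta$, intersections at limits; $\mathrm{rk}(D)$ = least $\eta$ with $D^\eta(X)=\emptyset$. $\beta(f)=\sup_{\varepsilon>0}\mathrm{rk}(D_{f,\varepsilon})$, $D_{f,\varepsilon}(F)=\{x\in F:\inf_{U\ni x\text{ open}}\sup_{x_1,x_2\in U\cap F}|f(x_1)-f(x_2)|\ge\varepsilon\}$. $\gamma(f)=\min\{\sup_{\varepsilon>0}\mathrm{rk}(D_{(f_n),\varepsilon}):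 f_n\text{ continuous}, f_n\to f\text{ pointwise}\}$, $D_{(f_n),\varepsilon}(F)=\{x\in F:\inf_{U\ni x\text{ open}}\inf_N\sup\{|f_m(y)-f_n(y)|:n,m\ge N,y\in U\cap F\}\ge\varepsilon\}$. *)

(* Defs.v *)
From HB Require Import structures.
From mathcomp Require Import all_boot all_order all_algebra.
From mathcomp Require Import all_classical all_reals all_analysis.

Set Implicit Arguments.
Unset Strict Implicit.
Unset Printing Implicit Defensive.

Import Order.TTheory GRing.Theory Num.Theory.
Import numFieldNormedType.Exports.

Local Open Scope classical_set_scope.
Local Open Scope ring_scope.

(* The trees below denote exactly the ordinals < omega_1.  [OSup u] denotes
   sup_n (u n) for an arbitrary sequence u, not necessarily increasing, so one
   ordinal has many trees: [ole] is a total well-founded preorder, and two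
   trees denote the same ordinal iff they are [oeq]. *)
Inductive cord : Type :=
| OZero
| OSucc of cord
| OSup of (nat -> cord).

HB.instance Definition _ := gen_eqMixin cord.
HB.instance Definition _ := gen_choiceMixin cord.

(* The clauses for [a.+1 <= b] say: never if b = 0; a <= b' if b = b'.+1;
   a.+1 <= u n for some n if b = sup_n (u n). *)
Fixpoint ole (a : cord) : cord -> Prop :=
  match a with
  | OZero => fun=> True
  | OSucc a' =>
      fix aux (b : cord) : Prop :=
        match b with
        | OZero => False
        | OSucc b' => ole a' b'
        | OSup u => exists n, aux (u n)
        end
  | OSup u => fun b => forall n, ole (u n) b
  end.

Definition olt (a b : cord) : Prop := ole (OSucc a) b.
Definition oeq (a b : cord) : Prop := ole a b /\ ole b a.
Definition OOne : cord := OSucc OZero.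

Lemma ole_succr a b : ole a b -> ole a (OSucc b).
Proof.
elim: a b => [//|a IHa|u IHu] b /=; last by move=> h n; apply: IHu.
elim: b => [//|b _ /IHa //|v IHv] /= [n /IHv] /=.
elim: a {IHa IHv} => [//|a IHa|w IHw] /=; first by exists n.
by move=> h m; apply: IHw.
Qed.

Lemma ole_sup a u n : ole a (u n) -> ole a (OSup u).
Proof.
elim: a => [//|a _|w IHw] /=; first by exists n.
by move=> h m; apply: IHw.
Qed.

Lemma ole_refl a : ole a a.
Proof. by elim: a => //= u IHu n; apply: ole_sup (IHu n). Qed.

Lemma ole_trans b a c : ole a b -> ole b c -> ole a c.
Proof.
elim: b a c => [|b IHb|v IHv] a c.
- elim: a => [//|//|u IHu] /= h _ n; exact: IHu.
- elim: a => [//|a _|u IHu] /=; last by move=> h bc n; apply: IHu.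
  move=> ab; elim: c => [//|c _ /(IHb _ _ ab) //|w IHw] /= [n /IHw h].
  by exists n.
- elim: a => [//|a _|u IHu] /=; last by move=> h vc n; apply: IHu.
  by move=> [n an] vc; apply: (IHv n (OSucc a)).
Qed.

Lemma ole_or_olt a b : ole a b \/ olt b a.
Proof.
elim: a b => [|a IHa|u IHu] b; first by left.
- elim: b => [|b _|v IHv]; first by right.
    by case: (IHa b); [left|right].
  have [[n h]|h] := pselect (exists n, ole (OSucc a) (v n)).
    by left; exists n.
  right => n /=; case: (IHv n) => // h'; by case: h; exists n.
- have [h|/existsNP[n h]] := pselect (forall n, ole (u n) b); first by left.
  by right; exists n; case: (IHu n b).
Qed.

Lemma ole_total a b : ole a b \/ ole b a.
Proof.
case: (ole_or_olt a b) => h; [by left|right].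
by apply: ole_trans h; apply/ole_succr/ole_refl.
Qed.

Lemma olt_wf : well_founded olt.
Proof.
suff h b a : olt a b -> Acc olt a.
  by move=> a; apply: (h (OSucc a)); apply: ole_refl.
elim: b a => [//|b IHb|u IHu] a /=; last by case=> n; apply: IHu.
by move=> ab; constructor => c ca; apply: IHb; apply: ole_trans ca ab.
Qed.

Fixpoint oadd (a b : cord) : cord :=
  match b with
  | OZero => a
  | OSucc b' => OSucc (oadd a b')
  | OSup u => OSup (fun n => oadd a (u n))
  end.

Fixpoint omuln (a : cord) (n : nat) : cord :=
  if n is n'.+1 then oadd (omuln a n') a else OZero.

(* omega ^ eta, using omega ^ (eta + 1) = sup_n (omega ^ eta * n). *)
Fixpoint omega_pow (eta : cord) : cord :=
  match eta with
  | OZero => OOne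
  | OSucc eta' => OSup (omuln (omega_pow eta'))
  | OSup u => OSup (fun n => omega_pow (u n))
  end.

(* [None] denotes omega_1. *)
Definition rank_value : Type := option cord.

Definition rle (x y : rank_value) : Prop :=
  match x, y with
  | _, None => True
  | None, Some _ => False
  | Some a, Some b => ole a b
  end.

(* Least element; omega_1 for the empty set. *)
Definition rmin (S : set rank_value) : rank_value :=
  xget None [set x | S x /\ forall y, S y -> rle x y].

Definition rsup (S : set rank_value) : rank_value :=
  rmin [set y | forall x, S x -> rle x y].

Definition rmax (x y : rank_value) : rank_value :=
  if pselect (rle x y) then y else x.

Lemma rmin_spec (S : set rank_value) : S !=set0 ->
  S (rmin S) /\ forall y, S y -> rle (rmin S) y.
Proof.
move=> [x0 Sx0]; suff [x Px] : exists x, S x /\ forall y, S y -> rle x y.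
  apply: (@xgetPex _ None [set z | S z /\ forall y, S y -> rle z y]).
  by exists x.
have [[a Sa]|nS] := pselect (exists a, S (Some a)); last first.
  exists x0; split => // -[b Sb|]; last by case: x0 Sx0.
  by case: nS; exists b.
elim/(well_founded_ind olt_wf): a Sa => a IHa Sa.
have [[b [Sb ba]]|h] := pselect (exists b, S (Some b) /\ olt b a).
  exact: (IHa b).
exists (Some a); split => // -[b Sb|//] /=.
by case: (ole_or_olt a b) => // ba; case: h; exists b.
Qed.

Definition ress_le (theta theta' : rank_value) : Prop :=
  forall eta : cord, ole OOne eta ->
    rle theta' (Some (omega_pow eta)) -> rle theta (Some (omega_pow eta)).

Definition ress_eq (theta theta' : rank_value) : Prop :=
  ress_le theta theta' /\ ress_le theta' theta.

(* When D F is a subset of F for all F, the iterates decrease with eta, so the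
   last clause is right for every sequence u, even if sup u is attained. *)
Fixpoint diter (T : Type) (D : set T -> set T) (eta : cord) (F : set T) :
    set T :=
  match eta with
  | OZero => F
  | OSucc eta' => D (diter D eta' F)
  | OSup u => \bigcap_n diter D (u n) F
  end.

Definition rk (T : Type) (D : set T -> set T) : rank_value :=
  rmin [set Some eta | eta in [set eta | diter D eta setT = set0]].

Section topological_notions.
Context {R : realType} {T : topologicalType}.

Definition complete_compatible_metric (d : T -> T -> R) : Prop :=
  [/\ forall x y, d x y = 0 <-> x = y,
      forall x y, d x y = d y x,
      forall x y z, d x z <= d x y + d y z,
      forall x (A : set T),
        nbhs x A <-> exists2 e : R, 0 < e & [set y | d x y < e] `<=` A
    & forall u : nat -> T,
        (forall e : R, 0 < e -> exists N : nat, forall m n : nat,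
           (N <= m)%N -> (N <= n)%N -> d (u m) (u n) < e) ->
        exists x : T, u n @[n --> \oo] --> x].

Definition polish : Prop :=
  (exists2 S : set T, countable S & dense S) /\
  (exists d : T -> T -> R, complete_compatible_metric d).

(* The additive Borel class Sigma^0_xi; it is empty for xi = 0. *)
Inductive Sigma0 : cord -> set T -> Prop :=
| Sigma0_open xi (A : set T) : oeq xi OOne -> open A -> Sigma0 xi A
| Sigma0_bigcup xi (zeta : nat -> cord) (A : nat -> set T) :
    (forall n, olt (zeta n) xi) -> (forall n, Sigma0 (zeta n) (A n)) ->
    Sigma0 xi (\bigcup_n ~` A n).

(* Baire class 0 is continuity; a Baire class xi >= 1 function is a pointwise
   limit of functions of smaller classes. *)
Inductive baire_class : cord -> (T -> R) -> Prop :=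
| baire_class0 xi (f : T -> R) :
    oeq xi OZero -> continuous f -> baire_class xi f
| baire_class_lim xi (zeta : nat -> cord) (h : nat -> T -> R) (f : T -> R) :
    (forall n, olt (zeta n) xi) -> (forall n, baire_class (zeta n) (h n)) ->
    (forall x, h n x @[n --> \oo] --> f x) -> baire_class xi f.

Definition oscillation (f : T -> R) (F : set T) (x : T) : \bar R :=
  ereal_inf [set ereal_sup [set `|f p.1 - f p.2|%:E | p in
                              (U `&` F) `*` (U `&` F)]
            | U in [set U : set T | open U /\ U x]].

Definition D_beta (f : T -> R) (eps : R) (F : set T) : set T :=
  [set x | F x /\ (eps%:E <= oscillation f F x)%E].

Definition beta (f : T -> R) : rank_value :=
  rsup [set rk (D_beta f eps) | eps in [set eps : R | 0 < eps]].

Definition seq_oscillation (h : nat -> T -> R) (F : set T) (x : T) : \bar R :=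
  ereal_inf [set ereal_inf (range (fun N : nat =>
               ereal_sup [set r : \bar R | exists n m y,
                 [/\ (N <= n)%N, (N <= m)%N, (U `&` F) y
                   & r = `|h m y - h n y|%:E]]))
            | U in [set U : set T | open U /\ U x]].

Definition D_gamma (h : nat -> T -> R) (eps : R) (F : set T) : set T :=
  [set x | F x /\ (eps%:E <= seq_oscillation h F x)%E].

Definition gamma (f : T -> R) : rank_value :=
  rmin [set rsup [set rk (D_gamma h eps) | eps in [set eps : R | 0 < eps]]
       | h in [set h : nat -> T -> R | (forall n, continuous (h n)) /\
                                       forall x, h n x @[n --> \oo] --> f x]].

End topological_notions.

Arguments polish R T : clear implicits.

Record topology_on (T : Type) : Type := TopologyOn {
  opens :> set (set T);
  opensT : opens setT;
  opensI : forall A B, opens A -> opens B -> opens (A `&` B);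
  opens_bigU : forall (I : Type) (A : I -> set T),
    (forall i, opens (A i)) -> opens (\bigcup_i A i)
}.

Definition retop (T : Type) (tau : topology_on T) : Type := T.

HB.instance Definition _ (T : choiceType) (tau : topology_on T) :=
  Choice.on (retop tau).
HB.instance Definition _ (T : choiceType) (tau : topology_on T) :=
  @isOpenTopological.Build (retop tau) (opens tau)
    (opensT tau) (@opensI _ tau) (@opens_bigU _ tau).

Lemma open_retop (T : choiceType) (tau : topology_on T) :
  (open : set (set (retop tau))) = opens tau.
Proof. by []. Qed.

Section star_ranks.
Context {R : realType} {T : topologicalType}.

Definition refinements (xi : cord) (f : T -> R) : set (topology_on T) :=
  [set tau | [/\ polish R (retop tau),
                 (open : set (set T)) `<=` tau,
                 tau `<=` Sigma0 xi
               & baire_class OOne (f : retop tau -> R)]].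

Definition beta_star (xi : cord) (f : T -> R) : rank_value :=
  rmin [set beta (f : retop tau -> R) | tau in refinements xi f].

Definition gamma_star (xi : cord) (f : T -> R) : rank_value :=
  rmin [set gamma (f : retop tau -> R) | tau in refinements xi f].

Definition essentially_linear (C : set (T -> R))
    (rho : (T -> R) -> rank_value) : Prop :=
  (forall (f : T -> R) (c : R), C f -> c != 0 ->
     ress_eq (rho (fun x => c * f x)) (rho f)) /\
  (forall f g : T -> R, C f -> C g ->
     ress_le (rho (fun x => f x + g x)) (rmax (rho f) (rho g))).

End star_ranks.

(* Main.v *)
(* If [tau1] and [tau2] witness the ranks of [f] and [g], their join is a Polish
   topology (the sum of two compatible complete metrics is one), stays inside
   Sigma^0_xi, and refining a topology only decreases beta and gamma; so it
   suffices to treat [f + g] in one topology.  There the derivative [D] of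
   [f + g] at level eps satisfies [D F <= D0 F u D1 F] for the derivatives of [f]
   and [g] at level eps / 2.  Since derivatives are local and preserve closed
   sets, induction on eta gives
   [D^(omega^eta) F <= D0^(omega^eta) F u D1^(omega^eta) F]: at a successor, the
   iterate [D^(omega^eta * k) F] is covered by the sets [P_i n Q_j] with
   [i + j = k], where [P_i = D0^(omega^eta * i) F], [Q_j = D1^(omega^eta * j) F]. *)
Require Import Defs.
From mathcomp Require Import all_boot all_order all_algebra.
From mathcomp Require Import lra zify.
From mathcomp Require Import all_classical all_reals all_analysis.

Set Implicit Arguments.
Unset Strict Implicit.
Unset Printing Implicit Defensive.

Import Order.TTheory GRing.Theory Num.Theory.
Import numFieldNormedType.Exports.

Local Open Scope classical_set_scope.
Local Open Scope ring_scope.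

(** * Rank values and iterated derivatives *)

Lemma rle_trans y x z : rle x y -> rle y z -> rle x z.
Proof. by case: x y z => [a|] [b|] [c|] //=; apply: ole_trans. Qed.

(** Reduces comparisons of ranks to upper bounds by countable ordinals: if [y] is countable, take
    [a] to be [y] itself, and omega_1 bounds everything. *)
Lemma rleP x y :
  (forall a, rle y (Some a) -> rle x (Some a)) -> rle x y.
Proof.
by case: y => [b|]; [move=> h; exact/h/ole_refl | case: x].
Qed.

(** A nonempty set attains its minimum; for the empty one the value is omega_1, which lies below no
    [Some a], so both sides fail. *)
Lemma rmin_leP (S : set rank_value) a :
  rle (rmin S) (Some a) <-> exists2 y, S y & rle y (Some a).
Proof.
have [S0|S0] := pselect (S !=set0).
  have [Sm mS] := rmin_spec S0.
  by split=> [?|[y Sy]]; [exists (rmin S) | apply: rle_trans (mS _ Sy)].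
split=> [|[y Sy _]]; last by case: S0; exists y.
by rewrite /rmin xgetPN // => x [Sx _]; case: S0; exists x.
Qed.

(** The set of upper bounds contains omega_1, so it has a least element. *)
Lemma rsup_leP (S : set rank_value) y :
  rle (rsup S) y <-> forall x, S x -> rle x y.
Proof.
have /rmin_spec[ub least] :
    [set y : rank_value | forall x, S x -> rle x y] !=set0.
  by exists None => -[].
by split=> [h x /ub xs|/least //]; exact: rle_trans h.
Qed.

Lemma rmax_leP x y z : rle (rmax x y) z <-> rle x z /\ rle y z.
Proof.
rewrite /rmax; case: pselect => [xy|nxy].
  by split=> [h|[]//]; split=> //; exact: rle_trans h.
split=> [h|[]//]; split=> //; apply: rle_trans h.
by case: x y nxy => [a|] [b|] //= nab; case: (ole_total a b).
Qed.

Section derivatives.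
Context {T : Type}.
Implicit Types (D : set T -> set T) (F G : set T).

Definition shrinking D := forall F, D F `<=` F.
Definition monotone D := forall F G, F `<=` G -> D F `<=` D G.

Lemma diter_sub D a F : shrinking D -> diter D a F `<=` F.
Proof.
move=> sD; elim: a => [//|a IH|u IH] x /=; first by move=> /sD /IH.
by move=> /(_ 0%N I) /IH.
Qed.

Lemma diter_subset D D' a F G : monotone D' ->
  (forall H, D H `<=` D' H) -> F `<=` G -> diter D a F `<=` diter D' a G.
Proof.
move=> mD' DD' FG; elim: a => [//|a IH|u IH] x /=.
  by move=> /DD'; apply: mD'.
by move=> h n _; apply/IH/h.
Qed.

Lemma diter_ole D a b F : shrinking D -> monotone D ->
  ole a b -> diter D b F `<=` diter D a F.
Proof.
move=> sD mD; elim: a b => [|a IHa|u IHu] b /=.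
- by move=> _; exact: diter_sub.
- elim: b => [//|b _ /IHa /mD //|v IHv] [n /IHv h] x /(_ n I) /=.
  exact: h.
- by move=> h x Dx n _; apply: IHu Dx.
Qed.

Lemma diter_oadd D a b F : diter D (oadd a b) F = diter D b (diter D a F).
Proof.
by elim: b => [//|b /= ->//|u IH] /=; apply: eq_bigcapr => n _.
Qed.

(** Iterates decrease, so one that is empty at a stage [b] below [a] is still empty at [a]. *)
Lemma rk_leP D a : shrinking D -> monotone D ->
  rle (rk D) (Some a) <-> diter D a setT = set0.
Proof.
move=> sD mD; rewrite rmin_leP; split=> [[_ [b Db <-] /= ba]|Da]; last first.
  by exists (Some a); [exists a | exact: ole_refl].
by apply/seteqP; split=> // x; rewrite -Db; apply: diter_ole.
Qed.

End derivatives.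

(** * Covering of iterates at powers of omega *)

Definition local_derivative (T : topologicalType) (D : set T -> set T) :=
  forall U F G : set T,
    open U -> U `&` F `<=` G -> U `&` D F `<=` D G.

(* [U], [P] and [Q] are there for the induction: a point of [P_i n Q_j] outside
   [P_(i+1)] and [Q_(j+1)] has an open neighbourhood in which the iterate reached
   so far lies in [P_i n Q_j] only, and the hypothesis is applied to it. *)
Lemma diter_omega_pow_subU (T : topologicalType) (D D0 D1 : set T -> set T)
    eta (U S P Q : set T) :
  shrinking D -> shrinking D0 -> shrinking D1 ->
  monotone D0 -> monotone D1 ->
  local_derivative D0 -> local_derivative D1 ->
  (forall a F, closed F -> closed (diter D0 a F)) ->
  (forall a F, closed F -> closed (diter D1 a F)) ->
  (forall F, D F `<=` D0 F `|` D1 F) ->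
  closed P -> closed Q -> open U -> U `&` S `<=` P `&` Q ->
  U `&` diter D (omega_pow eta) S `<=`
  diter D0 (omega_pow eta) P `|` diter D1 (omega_pow eta) Q.
Proof.
move=> sD s0 s1 m0 m1 l0 l1 c0 c1 D01.
elim: eta U S P Q => [|eta IH|u IH] U S P Q cP cQ oU USPQ x /= [Ux].
(* Here omega^0 = 1: a single step of [D], which locality carries from [S] to [P] or [Q]. *)
- move=> /D01[] Sx; [left; apply: (l0 U S P) | right; apply: (l1 U S Q)] => //;
  by move=> y /USPQ[].
- set w := omega_pow eta; rewrite -/w in IH.
  move=> Dx.
  pose p i := diter D0 (omuln w i) P; pose q i := diter D1 (omuln w i) Q.
  have pS i : p i.+1 = diter D0 w (p i) by rewrite /p /= diter_oadd.
  have qS i : q i.+1 = diter D1 w (q i) by rewrite /q /= diter_oadd.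
  have p_dec i j : (i <= j)%N -> p j `<=` p i.
    move=> /subnKC <-; elim: (j - i)%N => [|k IHk]; first by rewrite addn0.
    by rewrite addnS pS => y /(diter_sub s0) /IHk.
  have q_dec i j : (i <= j)%N -> q j `<=` q i.
    move=> /subnKC <-; elim: (j - i)%N => [|k IHk]; first by rewrite addn0.
    by rewrite addnS qS => y /(diter_sub s1) /IHk.
  have key k y : U y -> diter D (omuln w k) S y ->
      exists i j, [/\ (i + j)%N = k, p i y & q j y].
    elim: k y => [|k IHk] y Uy.
      by move=> Sy; have [] := USPQ y (conj Uy Sy); exists 0%N, 0%N.
    rewrite [omuln _ _]/= diter_oadd => Dy.
    have [i [j [ijk piy qjy]]] := IHk y Uy (diter_sub sD Dy).
    have [pi1y|npi1y] := pselect (p i.+1 y).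
      by exists i.+1, j; rewrite addSn ijk.
    have [qj1y|nqj1y] := pselect (q j.+1 y).
      by exists i, j.+1; rewrite addnS ijk.
    have cpi n : closed (p n) by exact: c0.
    have cqj n : closed (q n) by exact: c1.
    pose V := U `&` (~` p i.+1 `&` ~` q j.+1).
    have oV : open V.
      by apply: openI => //; apply: openI; exact: closed_openC.
    (* In [V] the indices supplied by [IHk] cannot exceed [i] and [j], because [p] and [q] decrease;
       their sum is still [k], so they equal [i] and [j]. *)
    have VS : V `&` diter D (omuln w k) S `<=` p i `&` q j.
      move=> z [[Uz [npz nqz]] Dz]; have [i' [j' [ij' piz qjz]]] := IHk z Uz Dz.
      have ii' : (i' <= i)%N.
        by rewrite leqNgt; apply/negP => /p_dec /(_ _ piz).
      have jj' : (j' <= j)%N.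
        by rewrite leqNgt; apply/negP => /q_dec /(_ _ qjz).
      have [ei ej] : i' = i /\ j' = j by lia.
      by rewrite -ei -ej.
    (* One more block of [w] steps inside [V]: the hypothesis for [eta] puts [y] into [p i.+1] or
       [q j.+1], both excluded by the choice of [V]. *)
    have := IH V _ _ _ (cpi i) (cqj j) oV VS y.
    by rewrite -pS -qS => -[]//.
  apply: contrapT => /not_orP[]; rewrite -/p.
  move=> /existsNP[n /not_implyP[_ npn]] /existsNP[m /not_implyP[_ nqm]].
  (* From [i + j = n + m] follows [n <= i] or [m <= j], and either contradicts the choice of [n] and
     [m]. *)
  have [i [j [ijk pix qjx]]] := key (n + m)%N x Ux (Dx (n + m)%N I).
  have [ni|ni] := leqP n i; first exact/npn/(p_dec _ _ ni).
  have mj : (m <= j)%N by lia.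
  exact/nqm/(q_dec _ _ mj).
- move=> Dx; apply: contrapT => /not_orP[].
  move=> /existsNP[n /not_implyP[_ npn]] /existsNP[m /not_implyP[_ nqm]].
  (* The stages [n] and [m] may differ; the one with the larger power serves for both, since
     iterates decrease. *)
  have [k [npk nqk]] : exists k, ~ diter D0 (omega_pow (u k)) P x /\
                                 ~ diter D1 (omega_pow (u k)) Q x.
    have [nm|mn] := ole_total (omega_pow (u n)) (omega_pow (u m)).
      by exists m; split => // /(diter_ole s0 m0 nm).
    by exists n; split => // /(diter_ole s1 m1 mn).
  by have [] := IH k U S P Q cP cQ oU USPQ x (conj Ux (Dx k I)).
Qed.

(** * Oscillation derivatives *)

Section oscillation_derivatives.
Context {R : realType}.

(* [Phi A e] reads "the oscillation on [A] is at most [e]". *)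
Definition osc_derivative (T : topologicalType) (Phi : set T -> R -> Prop)
    (eps : R) (F : set T) : set T :=
  [set x | F x /\ forall U e, open U -> U x -> Phi (U `&` F) e -> eps <= e].

Definition osc_rank (T : topologicalType) (Phi : set T -> R -> Prop) :
    rank_value :=
  rsup [set rk (osc_derivative Phi eps) | eps in [set eps : R | 0 < eps]].

Definition antitone (T : Type) (Phi : set T -> R -> Prop) :=
  forall A B e, A `<=` B -> Phi B e -> Phi A e.

Definition osc_le (T : Type) (f : T -> R) (A : set T) (e : R) : Prop :=
  forall y z, A y -> A z -> `|f y - f z| <= e.

(** The infimum over [N] in the oscillation of a sequence becomes an existential. *)
Definition tail_osc_le (T : Type) (h : nat -> T -> R) (A : set T) (e : R) :
    Prop :=
  exists N : nat, forall n m y, (N <= n)%N -> (N <= m)%N -> A y ->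
    `|h m y - h n y| <= e.

Lemma osc_le_antitone (T : Type) (f : T -> R) : antitone (osc_le f).
Proof. by move=> A B e AB h y z /AB Ay /AB Az; exact: h. Qed.

Lemma tail_osc_le_antitone (T : Type) (h : nat -> T -> R) :
  antitone (tail_osc_le h).
Proof. by move=> A B e AB [N hN]; exists N => n m y ? ? /AB; exact: hN. Qed.

Lemma osc_leD (T : Type) (f g : T -> R) A e e' :
  osc_le f A e -> osc_le g A e' -> osc_le (f \+ g) A (e + e').
Proof.
move=> hf hg y z Ay Az; rewrite /= opprD addrACA.
by apply: le_trans (ler_normD _ _) _; apply: lerD; [exact: hf | exact: hg].
Qed.

Lemma tail_osc_leD (T : Type) (h k : nat -> T -> R) A e e' :
  tail_osc_le h A e -> tail_osc_le k A e' ->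
  tail_osc_le (fun n => h n \+ k n) A (e + e').
Proof.
move=> [N hN] [M kM]; exists (maxn N M) => n m y.
rewrite !geq_max => /andP[Nn Mn] /andP[Nm Mm] Ay /=; rewrite opprD addrACA.
by apply: le_trans (ler_normD _ _) _; apply: lerD; [exact: hN | exact: kM].
Qed.

Lemma osc_leZ (T : Type) (f : T -> R) c A e :
  osc_le f A e -> osc_le (fun x => c * f x) A (`|c| * e).
Proof.
by move=> hf y z Ay Az; rewrite -mulrBr normrM ler_wpM2l // hf.
Qed.

Lemma tail_osc_leZ (T : Type) (h : nat -> T -> R) c A e :
  tail_osc_le h A e -> tail_osc_le (fun n x => c * h n x) A (`|c| * e).
Proof.
move=> [N hN]; exists N => n m y Nn Nm Ay.
by rewrite -mulrBr normrM ler_wpM2l // hN.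
Qed.

(** Lets real bounds replace the extended-real suprema in both oscillations. *)
Lemma le_ereal_supP (S : set (\bar R)) (eps : R) :
  (eps%:E <= ereal_sup S)%E <->
  forall e : R, (forall s, S s -> (s <= e%:E)%E) -> eps <= e.
Proof.
split=> [h e ub|h].
  by rewrite -lee_fin; apply: le_trans h _; exact: ge_ereal_sup.
rewrite leNgt; apply/negP; case E : (ereal_sup S) => [s| |] //.
- rewrite lte_fin ltNge => /negP; apply; apply: h => r Sr.
  by rewrite -E; exact: ereal_sup_ubound.
(* If the supremum is -oo, every real bounds [S], in particular [eps - 1]. *)
- move=> _; have : eps <= eps - 1.
    by apply: h => r /ereal_sup_ubound; rewrite E leeNy_eq => /eqP ->;
      rewrite leNye.
  by rewrite lerDl oppr_ge0 ler10.
Qed.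

Lemma D_betaE (T : topologicalType) (f : T -> R) :
  D_beta f = osc_derivative (osc_le f).
Proof.
apply/funext => eps; apply/funext => F; apply/seteqP.
split=> x [Fx /= h]; split=> //.
- move=> U e oU Ux hU.
  move/ereal_infP : h => /(_ _ (ex_intro2 _ _ U (conj oU Ux) erefl)).
  move=> /le_ereal_supP; apply => _ [[y z] [Uy Uz] <-].
  by rewrite lee_fin; exact: hU.
- apply/ereal_infP => _ [U [oU Ux] <-]; apply/le_ereal_supP => e hU.
  apply: (h U) => // y z Uy Uz; rewrite -lee_fin; apply: hU.
  by exists (y, z).
Qed.

Lemma D_gammaE (T : topologicalType) (h : nat -> T -> R) :
  D_gamma h = osc_derivative (tail_osc_le h).
Proof.
apply/funext => eps; apply/funext => F; apply/seteqP.
split=> x [Fx /= hx]; split=> //.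
- move=> U e oU Ux [N hN].
  move/ereal_infP : hx => /(_ _ (ex_intro2 _ _ U (conj oU Ux) erefl)).
  move=> /ereal_infP/(_ _ (ex_intro2 _ _ N I erefl)) /le_ereal_supP.
  by apply => _ [n [m [y [Nn Nm Uy ->]]]]; rewrite lee_fin hN.
- apply/ereal_infP => _ [U [oU Ux] <-]; apply/ereal_infP => _ [N _ <-].
  apply/le_ereal_supP => e hU; apply: (hx U) => //.
  by exists N => n m y Nn Nm Uy; rewrite -lee_fin; apply: hU; exists n, m, y.
Qed.

Lemma betaE (T : topologicalType) (f : T -> R) : beta f = osc_rank (osc_le f).
Proof. by rewrite /beta D_betaE. Qed.

Lemma gamma_leP (T : topologicalType) (f : T -> R) a :
  rle (gamma f) (Some a) <->
  exists h : nat -> T -> R, [/\ forall n, continuous (h n),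
    forall x, h n x @[n --> \oo] --> f x
    & rle (osc_rank (tail_osc_le h)) (Some a)].
Proof.
rewrite rmin_leP; split=> [[_ [h [ch hf] <-]]|[h [ch hf ha]]].
  by rewrite D_gammaE => ha; exists h.
by eexists; [exists h; [split|reflexivity] | rewrite D_gammaE].
Qed.

Section osc_derivative_theory.
Context {T : topologicalType} (Phi : set T -> R -> Prop).
Hypothesis Phi_anti : antitone Phi.

Lemma osc_derivative_shrinking eps : shrinking (osc_derivative Phi eps).
Proof. by move=> F x []. Qed.

Lemma osc_derivative_monotone eps : monotone (osc_derivative Phi eps).
Proof.
move=> F G FG x [/FG Gx h]; split=> // U e oU Ux UG.
by apply: (h U) => //; apply: Phi_anti UG; exact: setIS.
Qed.

(** A neighbourhood of [x] can be cut down to its intersection with [U], where [F] lies in [G]. *)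
Lemma osc_derivative_local eps : local_derivative (osc_derivative Phi eps).
Proof.
move=> U F G oU UFG x [Ux [Fx h]]; split; first exact: UFG.
move=> V e oV Vx VG; apply: (h (V `&` U)) => //; first exact: openI.
by apply: Phi_anti VG => y [[Vy Uy] Fy]; split=> //; exact: UFG.
Qed.

(** What is removed from [F] is its trace on the union of all open sets in which the oscillation has
    a bound below [eps]. *)
Lemma osc_derivative_closed eps F :
  closed F -> closed (osc_derivative Phi eps F).
Proof.
move=> cF; have -> : osc_derivative Phi eps F = F `&`
    ~` \bigcup_(U in [set U | open U /\ exists2 e, e < eps & Phi (U `&` F) e]) U.
  apply/seteqP; split=> x [Fx h]; split=> //.
    by move=> [U [oU [e le UF]] Ux]; have := h U e oU Ux UF; rewrite leNgt le.
  move=> U e oU Ux UF; rewrite leNgt; apply/negP => le; apply: h.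
  by exists U => //; split=> //; exists e.
by apply: closedI => //; apply: open_closedC; apply: bigcup_open => U [].
Qed.

Lemma diter_osc_derivative_closed eps a F :
  closed F -> closed (diter (osc_derivative Phi eps) a F).
Proof.
move=> cF; elim: a => [//|a IH|u IH] /=; first exact: osc_derivative_closed.
by apply: closed_bigI => n _; exact: IH.
Qed.

Lemma osc_rank_leP a : rle (osc_rank Phi) (Some a) <->
  forall eps, 0 < eps -> diter (osc_derivative Phi eps) a setT = set0.
Proof.
rewrite rsup_leP; split=> [h eps e0|h _ [eps e0 <-]]; apply/rk_leP;
  do ?[exact: osc_derivative_shrinking|exact: osc_derivative_monotone].
- by apply: h; exists eps.
- exact: h.
Qed.

End osc_derivative_theory.

(** The [Psi]-derivative at level [eps] lies in the [Phi]-derivative at level [eps / k], and the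
    supremum ranges over all positive levels. *)
Lemma osc_rankZ (T : topologicalType) (Phi Psi : set T -> R -> Prop)
    (k : R) :
  antitone Phi -> antitone Psi -> 0 < k ->
  (forall A e, Phi A e -> Psi A (k * e)) ->
  rle (osc_rank Psi) (osc_rank Phi).
Proof.
move=> aPhi aPsi k0 h; apply: rleP => a /osc_rank_leP Da.
apply/osc_rank_leP => // eps e0; apply/seteqP; split=> // x.
rewrite -(Da aPhi (eps / k)) ?divr_gt0//.
apply: (diter_subset (D' := osc_derivative Phi (eps / k))) => //.
  exact: osc_derivative_monotone.
move=> F y [Fy hy]; split=> // U e oU Uy UF.
by rewrite ler_pdivrMr // mulrC; apply: (hy U) => //; exact: h.
Qed.

(** Serves beta and gamma at once: all that is asked of the three oscillations is antitonicity and
    additivity of their bounds. *)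
Lemma osc_rankD (T : topologicalType) (Phi Psi Xi : set T -> R -> Prop) eta :
  antitone Phi -> antitone Psi -> antitone Xi ->
  (forall A e e', Phi A e -> Psi A e' -> Xi A (e + e')) ->
  rle (osc_rank Phi) (Some (omega_pow eta)) ->
  rle (osc_rank Psi) (Some (omega_pow eta)) ->
  rle (osc_rank Xi) (Some (omega_pow eta)).
Proof.
move=> aPhi aPsi aXi h /osc_rank_leP hPhi /osc_rank_leP hPsi.
apply/osc_rank_leP => // eps e0; apply/seteqP; split=> // x Dx.
have e20 : 0 < eps / 2 by rewrite divr_gt0.
suff : (diter (osc_derivative Phi (eps / 2)) (omega_pow eta) setT `|`
        diter (osc_derivative Psi (eps / 2)) (omega_pow eta) setT) x.
  by rewrite hPhi // hPsi // setU0.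
apply: (@diter_omega_pow_subU _ (osc_derivative Xi eps) _ _ eta setT setT) => //;
  do ?[exact: osc_derivative_shrinking|exact: osc_derivative_monotone
      |exact: osc_derivative_local
      |move=> ? ?; exact: diter_osc_derivative_closed
      |exact: closedT|exact: openT].
(* Outside both derivatives, [y] has neighbourhoods [U] and [V] with bounds [e] and [e'] below
   [eps / 2]; on their intersection [e + e'] is a bound below [eps]. *)
move=> F y [Fy hy]; apply: contrapT => /not_orP[].
move=> /not_andP[//|/existsNP[U /existsNP[e]]].
move=> /not_implyP[oU /not_implyP[Uy /not_implyP[UF /negP]]].
rewrite -ltNge => le.
move=> /not_andP[//|/existsNP[V /existsNP[e']]].
move=> /not_implyP[oV /not_implyP[Vy /not_implyP[VF /negP]]].
rewrite -ltNge => le'.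
have lee : eps <= e + e'.
  apply: (hy (U `&` V)) => //; first exact: openI.
  apply: h; first by apply: aPhi UF => z [[]].
  by apply: aPsi VF => z [[]].
lra.
Qed.

End oscillation_derivatives.

(** * Additive classes and joins of Polish topologies *)

Section metric.
Context {R : realType} {T : topologicalType} (d : T -> T -> R).
Hypothesis dP : complete_compatible_metric d.

Lemma dist_xx x : d x x = 0.
Proof. by case: dP => d0 _ _ _ _; apply/d0. Qed.

Lemma dist_ge0 x y : 0 <= d x y.
Proof.
case: dP => _ sym tri _ _; have := tri x y x.
by rewrite (sym y x) dist_xx -mulr2n pmulrn_lge0.
Qed.

Lemma dist_ball_open x e : open [set y | d x y < e].
Proof.
case: dP => _ sym tri nb _; rewrite openE => y /= xy; apply/nb.
exists (e - d x y); first by rewrite subr_gt0.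
by move=> z /=; rewrite ltrBrDl; apply: le_lt_trans.
Qed.

Lemma dist_ball_nbhs x e : 0 < e -> nbhs x [set y | d x y < e].
Proof. by case: dP => _ _ _ nb _ e0; apply/nb; exists e. Qed.

Lemma compatible_metric_hausdorff (u : nat -> T) (x y : T) :
  u n @[n --> \oo] --> x -> u n @[n --> \oo] --> y -> x = y.
Proof.
case: dP => d0 sym tri nb _ ux uy; apply/d0/le_anti.
rewrite dist_ge0 andbT leNgt; apply/negP => xy0.
have e0 : 0 < d x y / 2 by rewrite divr_gt0.
have [N _ hN] := ux _ (dist_ball_nbhs x e0).
have [M _ hM] := uy _ (dist_ball_nbhs y e0).
have /= h1 := hN (maxn N M) (leq_maxl _ _).
have /= h2 := hM (maxn N M) (leq_maxr _ _).
have := tri x (u (maxn N M)) y; rewrite (sym (u _) y) leNgt => /negP; apply.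
by rewrite [ltRHS]splitr ltrD.
Qed.

Lemma dist_ball_self x e : 0 < e -> [set y | d x y < e] x.
Proof. by rewrite /= dist_xx. Qed.

Lemma open_Fsigma (A : set T) : open A ->
  exists B : nat -> set T, (forall n, open (B n)) /\ A = \bigcup_n ~` B n.
Proof.
case: dP => _ sym tri nb _ oA.
(* The n-th set is the open 1/(n+1)-neighbourhood of the complement of [A]; a point of [A] lies
   outside it once 1/(n+1) is below the radius of a ball inside [A]. *)
exists (fun n => \bigcup_(x in ~` A) [set y | d x y < n.+1%:R^-1]); split.
  by move=> n; apply: bigcup_open => x _; exact: dist_ball_open.
apply/seteqP; split=> x.
  move=> Ax; have : nbhs x A by exact: open_nbhs_nbhs.
  move=> /nb[e e0 eA]; have [n ne] := ltr_add_invr e0; rewrite add0r in ne.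
  exists n => // -[y nAy /= yx]; apply: nAy; apply: eA => /=.
  by rewrite sym; exact: lt_trans ne.
move=> [n _ h]; apply: contrapT => nAx; apply: h; exists x => //=.
by rewrite dist_xx invr_gt0.
Qed.

End metric.

(** * Closure properties of the additive Borel classes *)

Section additive_class.
Context {R : realType} {T : topologicalType} (d : T -> T -> R).
Hypothesis dP : complete_compatible_metric d.
Implicit Types (xi zeta : cord) (A B : set T).

Lemma Sigma0_ge1 xi A : Sigma0 xi A -> ole OOne xi.
Proof. by case=> [{}xi {}A []//|{}xi zeta B /(_ 0%N) + _]; exact: ole_trans. Qed.

Lemma not_olt_one xi : ole xi OOne -> ~ olt OOne xi.
Proof. by move=> x1 /ole_trans/(_ x1). Qed.

(** At level 1 the union constructor would need sets of a class below 1, and there are none. *)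
Lemma Sigma0_one xi A : Sigma0 xi A -> ole xi OOne -> open A.
Proof.
case=> [//|{}xi zeta B zxi /(_ 0%N)/Sigma0_ge1 z1 x1]; exfalso.
by apply: (not_olt_one x1); apply: ole_trans (zxi 0%N).
Qed.

Lemma Sigma0_bigcup_ex xi (B : nat -> set T) :
  (forall n, exists2 zeta, olt zeta xi & Sigma0 zeta (B n)) ->
  Sigma0 xi (\bigcup_n ~` B n).
Proof.
move=> h; apply: (@Sigma0_bigcup _ _ (fun n => s2val (cid2 (h n)))) => n;
by case: cid2.
Qed.

Lemma Sigma0_decompose xi A : olt OOne xi -> Sigma0 xi A ->
  exists2 B : nat -> set T, A = \bigcup_n ~` B n &
    forall n, exists2 zeta, olt zeta xi & Sigma0 zeta (B n).
Proof.
move=> + xA; case: xA => [{}xi {}A [/not_olt_one//]|{}xi zeta B zxi zB _].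
by exists B => // n; exists (zeta n).
Qed.

(** The constructor for open sets applies only at level 1, so leaving that level uses that an open
    set is a countable union of closed sets. *)
Lemma Sigma0_ole xi xi' A : ole xi xi' -> Sigma0 xi A -> Sigma0 xi' A.
Proof.
move=> + xA.
case: xA => [{}xi {}A [x1 x1'] oA|{}xi zeta B zxi zB] xx'; last first.
  by apply: Sigma0_bigcup zB => n; exact: ole_trans (zxi n) xx'.
have [x1''|lt] := ole_or_olt xi' OOne.
  by apply: Sigma0_open => //; split => //; exact: ole_trans xx'.
have [B [oB ->]] := open_Fsigma dP oA.
apply: Sigma0_bigcup_ex => n; exists OOne => //.
by apply: Sigma0_open => //; split; exact: ole_refl.
Qed.

Lemma open_Sigma0 xi A : ole OOne xi -> open A -> Sigma0 xi A.
Proof.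
move=> x1 oA; apply: Sigma0_ole x1 _.
by apply: Sigma0_open => //; split; exact: ole_refl.
Qed.

Lemma Sigma0_bigcupT xi (A : nat -> set T) :
  (forall n, Sigma0 xi (A n)) -> Sigma0 xi (\bigcup_n A n).
Proof.
move=> xA; have x1 := Sigma0_ge1 (xA 0%N).
have [x1'|lt] := ole_or_olt xi OOne.
  by apply: open_Sigma0 => //; apply: bigcup_open => n _; exact: Sigma0_one x1'.
pose B n := s2val (cid2 (Sigma0_decompose lt (xA n))).
have AB n : A n = \bigcup_m ~` B n m by rewrite /B; case: cid2.
have xB n m : exists2 zeta, olt zeta xi & Sigma0 zeta (B n m).
  by rewrite /B; case: cid2.
(* The double union is enumerated by codes of pairs; a number that codes no pair gives [B 0 0],
   which belongs to the union anyway. *)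
pose C k := let p := odflt (0%N, 0%N) (unpickle k) in B p.1 p.2.
have -> : \bigcup_n A n = \bigcup_k ~` C k.
  apply/seteqP; split=> x [n _].
    rewrite AB => -[m _ Bx]; exists (pickle (n, m)) => //.
    by rewrite /C /= pickleK.
  rewrite /C; case: (odflt _ _) => i j Bx.
  by exists i => //; rewrite AB; exists j.
by apply: Sigma0_bigcup_ex => k; exact: xB.
Qed.

(** An injection of [D] into the integers makes this a sequence of unions, the n-th being over the
    only index sent to [n], or empty. *)
Lemma Sigma0_bigcup_countable (I : Type) (D : set I) xi (F : I -> set T) :
  ole OOne xi -> countable D -> (forall i, D i -> Sigma0 xi (F i)) ->
  Sigma0 xi (\bigcup_(i in D) F i).
Proof.
move=> x1 /countable_injP[f finj] DF.
have -> : \bigcup_(i in D) F i =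
    \bigcup_n \bigcup_(i in [set i | D i /\ f i = n]) F i.
  apply/seteqP; split=> x; first by move=> [i Di Fx]; exists (f i) => //; exists i.
  by move=> [_ _ [i [Di _] Fx]]; exists i.
apply: Sigma0_bigcupT => n.
have [[i [Di fi]]|h] := pselect (exists i, D i /\ f i = n); last first.
  rewrite (_ : \bigcup_(i in _) _ = set0); first exact/open_Sigma0/open0.
  by apply/seteqP; split=> // x [i ? _]; apply: h; exists i.
rewrite (_ : [set i | _] = [set i]) ?bigcup_set1; first exact: DF.
apply/seteqP; split=> [j [Dj fj]|_ -> //].
by apply: finj; rewrite ?inE// fi fj.
Qed.

Lemma Sigma0_setU xi A B : Sigma0 xi A -> Sigma0 xi B -> Sigma0 xi (A `|` B).
Proof.
move=> xA xB; rewrite (_ : A `|` B = \bigcup_n (if n is 0%N then A else B)).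
  by apply: Sigma0_bigcupT => -[].
apply/seteqP; split=> x; first by case=> ?; [exists 0%N | exists 1%N].
by move=> [[|n] _]; [left | right].
Qed.

(** Above level 1, distributing gives a union of complements of [C n] u [D m], whose level is the
    larger of two levels below [xi]. *)
Lemma Sigma0_setI xi A B : Sigma0 xi A -> Sigma0 xi B -> Sigma0 xi (A `&` B).
Proof.
move=> xA xB; have x1 := Sigma0_ge1 xA.
have [x1'|lt] := ole_or_olt xi OOne.
  by apply: open_Sigma0 => //; apply: openI; exact: Sigma0_one x1'.
have [C -> xC] := Sigma0_decompose lt xA.
have [D -> xD] := Sigma0_decompose lt xB.
rewrite (_ : _ `&` _ = \bigcup_n \bigcup_m ~` (C n `|` D m)).
  apply: Sigma0_bigcupT => n; apply: Sigma0_bigcup_ex => m.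
  have [[z zx zC] [z' z'x z'D]] := (xC n, xD m).
  case: (ole_total z z') => [zz'|z'z].
    by exists z' => //; apply: Sigma0_setU => //; exact: Sigma0_ole zz' _.
  by exists z => //; apply: Sigma0_setU => //; exact: Sigma0_ole z'z _.
apply/seteqP; split=> x.
  by move=> [[n _ Cx] [m _ Dx]]; exists n => //; exists m => // -[].
by move=> [n _ [m _ /not_orP[Cx Dx]]]; split; [exists n | exists m].
Qed.

End additive_class.

(** * The join of two topologies *)

Section join_topology.
Context {T : Type} (tau1 tau2 : topology_on T).

(** The coarsest topology containing both, described through its base of intersections [U] n [V]. *)
Definition join_opens : set (set T) :=
  [set A | forall x, A x ->
     exists U V, [/\ opens tau1 U, opens tau2 V, U x, V x & U `&` V `<=` A]].

Lemma join_opensT : join_opens setT.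
Proof. by move=> x _; exists setT, setT; split=> //; exact: opensT. Qed.

Lemma join_opensI A B :
  join_opens A -> join_opens B -> join_opens (A `&` B).
Proof.
move=> hA hB x [/hA[U [V [oU oV Ux Vx UV]]] /hB[U' [V' [oU' oV' Ux' Vx' UV']]]].
exists (U `&` U'), (V `&` V'); split=> //; try exact: opensI.
by move=> y [[Uy U'y] [Vy V'y]]; split; [exact: UV | exact: UV'].
Qed.

Lemma join_opens_bigU (I : Type) (A : I -> set T) :
  (forall i, join_opens (A i)) -> join_opens (\bigcup_i A i).
Proof.
move=> hA x [i _ /hA[U [V [oU oV Ux Vx UV]]]].
by exists U, V; split=> // y /UV Ay; exists i.
Qed.

Definition join_topology : topology_on T :=
  TopologyOn join_opensT join_opensI join_opens_bigU.

Lemma subl_join_topology : tau1 `<=` join_topology.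
Proof.
move=> U oU x Ux; exists U, setT; split=> //.
all: by do ?[exact: opensT | move=> y []].
Qed.

Lemma subr_join_topology : tau2 `<=` join_topology.
Proof.
move=> U oU x Ux; exists setT, U; split=> //.
all: by do ?[exact: opensT | move=> y []].
Qed.

End join_topology.

Lemma nbhs_retopP (T : choiceType) (tau : topology_on T) (x : retop tau)
    (A : set T) :
  nbhs x A <-> exists U, [/\ opens tau U, U x & U `<=` A].
Proof.
rewrite nbhsE; split=> [[B [oB Bx] BA]|[U [oU Ux UA]]]; first by exists B.
by exists U.
Qed.

Lemma nbhs_join_topologyP (T : choiceType) (tau1 tau2 : topology_on T) (x : T)
    (A : set T) :
  @nbhs _ (retop (join_topology tau1 tau2)) x A <->
  exists U V : set T, [/\ @nbhs _ (retop tau1) x U, @nbhs _ (retop tau2) x V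
                  & U `&` V `<=` A].
Proof.
split=> [/nbhs_retopP[B [oB /oB[U [V [oU oV Ux Vx UV]]] BA]]|].
  exists U, V; split; last exact: subset_trans BA.
    by apply/nbhs_retopP; exists U; split.
  by apply/nbhs_retopP; exists V; split.
move=> [U [V [/nbhs_retopP[U' [oU' U'x UU']] /nbhs_retopP[V' [oV' V'x VV']] UV]]].
apply/nbhs_retopP; exists (U' `&` V'); split=> //.
- by move=> y [U'y V'y]; exists U', V'; split.
- by move=> y [/UU' Uy /VV' Vy]; exact: UV.
Qed.

Section polish_join.
Context {R : realType} {T : topologicalType} (tau1 tau2 : topology_on T).
Context (d0 d1 d2 : T -> T -> R).
Hypothesis dP0 : complete_compatible_metric d0.
Hypothesis dP1 : complete_compatible_metric (d1 : retop tau1 -> retop tau1 -> R).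
Hypothesis dP2 : complete_compatible_metric (d2 : retop tau2 -> retop tau2 -> R).
Hypothesis tau1_fine : open `<=` opens tau1.
Hypothesis tau2_fine : open `<=` opens tau2.

Local Notation tau := (join_topology tau1 tau2).

Lemma cvg_coarser (sigma : topology_on T) (u : nat -> T) (x : T) :
  open `<=` opens sigma ->
  (u : nat -> retop sigma) n @[n --> \oo] --> (x : retop sigma) ->
  u n @[n --> \oo] --> x.
Proof.
move=> fine ux A; rewrite nbhsE => -[B [oB Bx] BA]; apply: ux.
by apply/nbhs_retopP; exists B; split=> //; exact: fine.
Qed.

(** For completeness, a Cauchy sequence for the sum is Cauchy for [d1] and [d2]; its two limits are
    also limits in the original coarser topology, where limits are unique, so they coincide. *)
Lemma join_complete_compatible_metric :
  complete_compatible_metric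
    ((fun x y => d1 x y + d2 x y) : retop tau -> retop tau -> R).
Proof.
have ge1 : forall x y, 0 <= d1 x y := dist_ge0 dP1.
have ge2 : forall x y, 0 <= d2 x y := dist_ge0 dP2.
have [z1 s1 t1 n1 c1] := dP1; have [z2 s2 t2 n2 c2] := dP2.
split.
- move=> x y; split=> [|->]; last by rewrite (dist_xx dP1) (dist_xx dP2) addr0.
  by move/eqP; rewrite paddr_eq0 // => /andP[/eqP/z1].
- by move=> x y; rewrite s1 s2.
- by move=> x y z; rewrite addrACA; apply: lerD; [exact: t1 | exact: t2].
- move=> x A; split.
    move=> /nbhs_join_topologyP[U [V [/n1[e e0 eU] /n2[e' e'0 eV] UV]]].
    exists (Num.min e e'); first by rewrite lt_min e0.
    move=> y /=; rewrite lt_min => /andP[le le']; apply: UV; split.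
      by apply: eU => /=; apply: le_lt_trans le; rewrite lerDl.
    by apply: eV => /=; apply: le_lt_trans le'; rewrite lerDr.
  move=> [e e0 eA]; apply/nbhs_join_topologyP.
  have e20 : 0 < e / 2 by rewrite divr_gt0.
  exists [set y | d1 x y < e / 2], [set y | d2 x y < e / 2]; split.
  + exact: (dist_ball_nbhs dP1).
  + exact: (dist_ball_nbhs dP2).
  + by move=> y [/= xy1 xy2]; apply: eA => /=; rewrite [ltRHS]splitr ltrD.
- move=> u cauchy.
  have [x ux] : exists x : retop tau1, (u : nat -> retop tau1) n @[n --> \oo] --> x.
    apply: c1 => e /cauchy[N hN]; exists N => m n Nm Nn.
    by apply: le_lt_trans (hN m n Nm Nn); rewrite lerDl.
  have [y uy] : exists y : retop tau2, (u : nat -> retop tau2) n @[n --> \oo] --> y.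
    apply: c2 => e /cauchy[N hN]; exists N => m n Nm Nn.
    by apply: le_lt_trans (hN m n Nm Nn); rewrite lerDr.
  have xy : x = y.
    exact: (compatible_metric_hausdorff dP0 (cvg_coarser tau1_fine ux)
                                            (cvg_coarser tau2_fine uy)).
  rewrite -{y}xy in uy; exists x => A.
  move=> /nbhs_join_topologyP[U [V [/ux uU /uy uV UV]]].
  by apply: filterS UV _; exact: filterI.
Qed.

Context (S1 S2 : set T).
Hypothesis countable_S1 : countable S1.
Hypothesis countable_S2 : countable S2.
Hypothesis dense_S1 : dense (S1 : set (retop tau1)).
Hypothesis dense_S2 : dense (S2 : set (retop tau2)).

(** The two balls have independent centres because [S1] and [S2] are dense in different topologies,
    and no countable set dense in the join is at hand yet. *)
Definition join_ball (p : T * T * nat) : set T :=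
  [set y | d1 p.1.1 y < p.2.+1%:R^-1] `&` [set y | d2 p.1.2 y < p.2.+1%:R^-1].

Definition join_centers : set (T * T * nat) := S1 `*` S2 `*` setT.

Lemma countable_join_centers : countable join_centers.
Proof. by apply: countableX => //; exact: countableX. Qed.

Lemma join_ball_basis A x : opens tau A -> A x ->
  exists p, [/\ join_centers p, join_ball p x & join_ball p `<=` A].
Proof.
move=> oA Ax; have [_ _ _ nb _] := join_complete_compatible_metric.
have [|e e0 eA] := (nb x A).1; first by apply/nbhs_retopP; exists A; split.
have [_ s1 t1 _ _] := dP1; have [_ s2 t2 _ _] := dP2.
(* The radius is below e/4: [d1] and [d2] get e/2 each, split again between the ways from [x] to the
   centre and from the centre to [y]. *)
have e40 : 0 < e / 2 / 2 by rewrite !divr_gt0.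
have [n] := ltr_add_invr e40; rewrite add0r => ne.
have r0 : (0 : R) < n.+1%:R^-1 by rewrite invr_gt0.
have [p1 [xp1 Sp1]] := dense_S1 (ex_intro _ x (dist_ball_self dP1 x r0))
  (dist_ball_open dP1 x n.+1%:R^-1).
have [p2 [xp2 Sp2]] := dense_S2 (ex_intro _ x (dist_ball_self dP2 x r0))
  (dist_ball_open dP2 x n.+1%:R^-1).
exists (p1, p2, n); split.
- by split.
- by split=> /=; [rewrite s1 | rewrite s2].
- move=> y [/= p1y p2y]; apply: eA => /=; rewrite [ltRHS]splitr; apply: ltrD.
    apply: le_lt_trans (t1 x p1 y) _; rewrite [ltRHS]splitr.
    by apply: ltrD; exact: lt_trans ne.
  apply: le_lt_trans (t2 x p2 y) _; rewrite [ltRHS]splitr.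
  by apply: ltrD; exact: lt_trans ne.
Qed.

Lemma join_polish : polish R (retop tau).
Proof.
split; last by exists (fun x y => d1 x y + d2 x y);
  exact: join_complete_compatible_metric.
have [[x0 _]|T0] := pselect ([set: T] !=set0); last first.
  exists set0 => // O [x _]; case: T0; by exists x.
(* One point of each basic set; [x0] is the default for empty ones, which is why the empty space was
   treated apart. *)
exists [set xget x0 (join_ball p) | p in join_centers].
  apply: sub_countable countable_join_centers; exact: card_image_le.
move=> O [x Ox] oO; have [p [Sp px pO]] := join_ball_basis oO Ox.
exists (xget x0 (join_ball p)); split; last by exists p.
by apply: pO; apply: xgetPex; exists x.
Qed.

(** An open set of the join is the union of the countably many basic sets inside it, each the
    intersection of two sets in the class. *)
Lemma join_topology_Sigma0 xi : ole OOne xi ->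
  opens tau1 `<=` Sigma0 xi -> opens tau2 `<=` Sigma0 xi ->
  opens tau `<=` Sigma0 xi.
Proof.
move=> x1 h1 h2 A oA.
have -> : A = \bigcup_(p in join_centers `&` [set p | join_ball p `<=` A])
    join_ball p.
  apply/seteqP; split=> x; last by move=> [p [_ pA] /pA].
  by move=> /(join_ball_basis oA)[p [Sp px pA]]; exists p.
apply: (Sigma0_bigcup_countable dP0) => //.
  by apply: sub_countable countable_join_centers; apply: subset_card_le => p [].
move=> p _; apply: (Sigma0_setI dP0).
  by apply: h1; exact: (dist_ball_open dP1).
by apply: h2; exact: (dist_ball_open dP2).
Qed.

End polish_join.

(** * Ranks in a refined topology *)

Section baire_class_one.
Context {R : realType}.

Lemma baire_class0P (T : topologicalType) zeta (f : T -> R) :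
  olt zeta OOne -> baire_class zeta f -> continuous f.
Proof.
move=> z1 zf; case: zf z1 => [//|xi zeta' h g + _ _].
by move=> /(_ 0%N)/ole_trans/[apply].
Qed.

Lemma baire_class1P (T : topologicalType) (f : T -> R) :
  baire_class OOne f <->
  exists h : nat -> T -> R, (forall n, continuous (h n)) /\
    forall x, h n x @[n --> \oo] --> f x.
Proof.
split=> [bf|[h [ch hf]]].
  case E : _ _ / bf => [xi g [x0 _] _|xi zeta h g zx zh hg].
    by rewrite -E in x0.
  by exists h; split=> // n; apply: baire_class0P (zh n); rewrite E.
apply: (@baire_class_lim _ _ OOne (fun=> OZero) h) => // n.
by apply: baire_class0 => //; split.
Qed.

Lemma baire_class1D (T : topologicalType) (f g : T -> R) :
  baire_class OOne f -> baire_class OOne g -> baire_class OOne (f \+ g).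
Proof.
move=> /baire_class1P[h [ch hf]] /baire_class1P[k [ck kg]].
apply/baire_class1P; exists (fun n => h n \+ k n).
split=> [n x|x]; first by apply: cvgD; [exact: ch | exact: ck].
exact: cvgD.
Qed.

Lemma baire_class1Z (T : topologicalType) (f : T -> R) c :
  baire_class OOne f -> baire_class OOne (fun x => c * f x).
Proof.
move=> /baire_class1P[h [ch hf]].
apply/baire_class1P; exists (fun n x => c * h n x).
split=> [n x|x]; first by apply: cvgMl_tmp; exact: ch.
exact: cvgMl_tmp.
Qed.

End baire_class_one.

Section refinement.
Context {R : realType} {T : choiceType} (tau tau' : topology_on T).
Hypothesis fine : opens tau `<=` opens tau'.

Lemma continuous_fine (U : topologicalType) (f : T -> U) :
  continuous (f : retop tau -> U) -> continuous (f : retop tau' -> U).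
Proof.
by move=> /continuousP cf; apply/continuousP => A oA; apply/fine/cf.
Qed.

Lemma baire_class1_fine (f : T -> R) :
  baire_class OOne (f : retop tau -> R) ->
  baire_class OOne (f : retop tau' -> R).
Proof.
move=> /baire_class1P[h [ch hf]]; apply/baire_class1P.
by exists h; split=> // n; apply: continuous_fine; exact: ch.
Qed.

(** A finer topology has more neighbourhoods to test, so every derivative shrinks. *)
Lemma osc_rank_fine (Phi : set T -> R -> Prop) : antitone Phi ->
  rle (osc_rank (Phi : set (retop tau') -> R -> Prop))
      (osc_rank (Phi : set (retop tau) -> R -> Prop)).
Proof.
move=> aPhi; apply: rleP => a /osc_rank_leP h; apply/osc_rank_leP => // eps e0.
apply/seteqP; split=> // x.
rewrite -[set0](h aPhi eps e0);
apply: (@diter_subset _ _ (@osc_derivative R (retop tau) Phi eps)) => //.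
  exact: osc_derivative_monotone.
by move=> F y [Fy hy]; split=> // U e /fine; exact: hy.
Qed.

End refinement.

Section rank_properties.
Context {R : realType}.

Lemma betaZ (T : topologicalType) (f : T -> R) c : c != 0 ->
  rle (beta (fun x => c * f x)) (beta f).
Proof.
move=> c0; rewrite !betaE; apply: (@osc_rankZ _ _ _ _ `|c|);
  do ?exact: osc_le_antitone.
- by rewrite normr_gt0.
- by move=> A e; exact: osc_leZ.
Qed.

Lemma gammaZ (T : topologicalType) (f : T -> R) c : c != 0 ->
  rle (gamma (fun x => c * f x)) (gamma f).
Proof.
move=> c0; apply: rleP => a /gamma_leP[h [ch hf ha]]; apply/gamma_leP.
exists (fun n x => c * h n x); split.
- by move=> n x; apply: cvgMl_tmp; exact: ch.
- by move=> x; exact: cvgMl_tmp.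
- apply: rle_trans ha; apply: (@osc_rankZ _ _ _ _ `|c|);
    do ?exact: tail_osc_le_antitone.
  + by rewrite normr_gt0.
  + by move=> A e; exact: tail_osc_leZ.
Qed.

Lemma betaD (T : topologicalType) (f g : T -> R) eta :
  rle (beta f) (Some (omega_pow eta)) -> rle (beta g) (Some (omega_pow eta)) ->
  rle (beta (f \+ g)) (Some (omega_pow eta)).
Proof.
rewrite !betaE; apply: osc_rankD; do ?exact: osc_le_antitone.
exact: osc_leD.
Qed.

Lemma gammaD (T : topologicalType) (f g : T -> R) eta :
  rle (gamma f) (Some (omega_pow eta)) ->
  rle (gamma g) (Some (omega_pow eta)) ->
  rle (gamma (f \+ g)) (Some (omega_pow eta)).
Proof.
move=> /gamma_leP[h [ch hf hr]] /gamma_leP[k [ck kg kr]]; apply/gamma_leP.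
exists (fun n => h n \+ k n); split.
- by move=> n x; apply: cvgD; [exact: ch | exact: ck].
- by move=> x; exact: cvgD.
- apply: osc_rankD hr kr; do ?exact: tail_osc_le_antitone.
  exact: tail_osc_leD.
Qed.

Lemma beta_fine (T : choiceType) (tau tau' : topology_on T) (f : T -> R) :
  opens tau `<=` opens tau' ->
  rle (beta (f : retop tau' -> R)) (beta (f : retop tau -> R)).
Proof.
by move=> fine; rewrite !betaE; apply: osc_rank_fine => //;
   exact: osc_le_antitone.
Qed.

(** A continuous approximating sequence remains one in the finer topology, and its rank can only
    drop there. *)
Lemma gamma_fine (T : choiceType) (tau tau' : topology_on T) (f : T -> R) :
  opens tau `<=` opens tau' ->
  rle (gamma (f : retop tau' -> R)) (gamma (f : retop tau -> R)).
Proof.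
move=> fine; apply: rleP => a /gamma_leP[h [ch hf ha]]; apply/gamma_leP.
exists h; split=> //; first by move=> n; apply: (continuous_fine fine); exact: ch.
by apply: rle_trans ha; apply: osc_rank_fine => //; exact: tail_osc_le_antitone.
Qed.

End rank_properties.

(** * Passage to the starred ranks *)

Section star.
Context {R : realType} {T : topologicalType}.
Hypothesis T_polish : polish R T.
Context (xi : cord).

Lemma refinementsZ (f : T -> R) c :
  refinements xi f `<=` refinements xi (fun x => c * f x).
Proof. by move=> tau [pt ft st bt]; split=> //; exact: baire_class1Z. Qed.

Lemma refinementsD (f g : T -> R) tau1 tau2 : ole OOne xi ->
  refinements xi f tau1 -> refinements xi g tau2 ->
  refinements xi (fun x => f x + g x) (join_topology tau1 tau2).
Proof.
move=> x1 [[[S1 cS1 dS1] [d1 dP1]] f1 s1 b1] [[[S2 cS2 dS2] [d2 dP2]] f2 s2 b2].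
have [_ [d0 dP0]] := T_polish; split.
- exact: (join_polish dP0 dP1 dP2 f1 f2 cS1 cS2 dS1 dS2).
- exact: subset_trans f1 (@subl_join_topology _ _ _).
- exact: (join_topology_Sigma0 dP0 dP1 dP2 f1 f2 cS1 cS2 dS1 dS2).
- apply: baire_class1D.
    exact: (baire_class1_fine (@subl_join_topology _ tau1 tau2) b1).
  exact: (baire_class1_fine (@subr_join_topology _ tau1 tau2) b2).
Qed.

(** Treats both ranks at once: what is required of [rho] is its behaviour under scaling and sums
    within one topology, and its decrease under refinement. *)
Lemma star_essentially_linear
    (rho : forall U : topologicalType, (U -> R) -> rank_value)
    (C : set (T -> R)) :
  ole OOne xi ->
  (forall (U : topologicalType) (f : U -> R) (c : R), c != 0 ->
     rle (rho U (fun x => c * f x)) (rho U f)) ->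
  (forall (U : topologicalType) (f g : U -> R) eta,
      rle (rho U f) (Some (omega_pow eta)) ->
     rle (rho U g) (Some (omega_pow eta)) ->
     rle (rho U (f \+ g)) (Some (omega_pow eta))) ->
  (forall (tau tau' : topology_on T) (f : T -> R), opens tau `<=` opens tau' ->
     rle (rho (retop tau') f) (rho (retop tau) f)) ->
  essentially_linear C
    (fun f => rmin [set rho (retop tau) f | tau in refinements xi f]).
Proof.
move=> x1 rhoZ rhoD rho_fine; pose rs (f : T -> R) :=
  rmin [set rho (retop tau) f | tau in refinements xi f].
have rsZ (f : T -> R) (c : R) : c != 0 -> rle (rs (fun x => c * f x)) (rs f).
  move=> c0; apply: rleP => a /rmin_leP[_ [tau rt <-] ha].
  apply/rmin_leP; exists (rho (retop tau) (fun x => c * f x)).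
    by exists tau => //; exact: refinementsZ.
  exact: rle_trans (rhoZ _ _ _ c0) ha.
split=> [f c _ c0|f g _ _ eta _].
  split=> eta _; apply: rle_trans; rewrite -/(rs _) -/(rs f); first exact: rsZ.
  (* The reverse inequality comes from scaling back by [c^-1]. *)
  have := rsZ (fun x => c * f x) c^-1; rewrite invr_eq0 => /(_ c0).
  rewrite (_ : (fun x => c^-1 * _) = f) //.
  by apply/funext => x; rewrite mulKf.
move=> /rmax_leP[/rmin_leP[_ [tau1 rt1 <-] h1] /rmin_leP[_ [tau2 rt2 <-] h2]].
apply/rmin_leP; exists (rho (retop (join_topology tau1 tau2)) (f \+ g)).
  by exists (join_topology tau1 tau2) => //; exact: refinementsD.
apply: rhoD.
  exact: rle_trans (rho_fine _ _ _ (@subl_join_topology _ _ _)) h1.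
exact: rle_trans (rho_fine _ _ _ (@subr_join_topology _ _ _)) h2.
Qed.

End star.

Theorem theorem5p14 (R : realType) (X : topologicalType) (xi : cord)
    (X_polish : polish R X) (X_uncountable : ~ countable [set: X]%classic)
    (xi_ge1 : ole OOne xi) :
  essentially_linear (baire_class xi) (@beta_star R X xi) /\
  essentially_linear (baire_class xi) (@gamma_star R X xi).
Proof.
split.
- apply: (star_essentially_linear X_polish (rho := @beta R)) => //.
  + exact: betaZ.
  + exact: betaD.
  + exact: beta_fine.
- apply: (star_essentially_linear X_polish (rho := @gamma R)) => //.
  + exact: gammaZ.
  + exact: gammaD.
  + exact: gamma_fine.
Qed.
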